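(* For every $n\in\mathbb{N}$ there exists a natural number $C=C(n)$ such that for all $k\geq C$, both propositions $F\left(\mathbb{N},k,\binom{n}{2}\right)$ and $F\left(\mathbb{N},k,\binom{n}{2}+1\right)$ hold.
   Context: For a set $V$ and natural numbers $k,m$, the proposition $F(V,k,m)$ states: for every colouring of the edges of the complete graph on vertex set $V$ using exactly $k$ colours, there is a subset $X\subset V$ (finite or infinite) such that the edges with both endpoints in $X$ use exactly $m$ distinct colours. *)

(* Defs.v *)
From mathcomp Require Export all_boot.
From mathcomp Require Export boolp classical_sets functions cardinality.

Set Implicit Arguments.
Unset Strict Implicit.
Unset Printing Implicit Defensive.

Local Open Scope classical_set_scope.
Local Open Scope card_scope.

Definition edges (V : Type) (X : set V) : set (set V) :=
  [set e | exists x y, [/\ X x, X y, x <> y & e = [set x; y]]].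

(* An edge colouring is a map c : set V -> T, of which only the values on
   edges matter; T is the (arbitrary) type of colours. *)
Definition colours_on (V T : Type) (c : set V -> T) (X : set V) : set T :=
  c @` edges X.

Definition F (V : Type) (k m : nat) : Prop :=
  forall (T : Type) (c : set V -> T),
    colours_on c [set: V] #= `I_k -> exists X : set V, colours_on c X #= `I_m.

(* Main.v *)
Require Import Defs.
From mathcomp Require Import finmap zify.

Set Implicit Arguments.
Unset Strict Implicit.
Unset Printing Implicit Defensive.

(* Let [m > 2] be the target (the case [m = 2] needs only two vertices with the
   same colours to two differently coloured edges).  If some vertex sees many
   colours, a canonical-Ramsey argument inside its neighbourhood gives
   either a large rainbow clique or a structure (a clique whose edges are
   coloured by their first, or by their last, endpoint, or a monochromatic
   clique with a rainbow apex) in which vertices can be added one at a time,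
   each creating at most one new colour, so that every number of colours is
   met.  If every vertex sees few colours, many colours yield a large rainbow
   matching whose cross edges depend only on the kind of endpoint, and again
   vertices can be added creating one colour at a time.  Finally, a rainbow
   clique contains sets with exactly ['C(n, 2)] colours; as there are infinitely
   many vertices, some two vertices [y], [z] outside it have the same colours to
   it.  If many of these colours agree, [y] adds one colour to a rainbow
   [n]-clique; if many differ, [y] extends a rainbow [(n-1)]-clique to an
   [n]-clique and [z] adds only the colour of [yz]. *)

(** * Pigeonhole and greedy selection in finite lists *)

(** Greedy choice: if the class of the head has at most [p] elements, discarding it leaves room for
    the other values, all different from that of the head. *)
Lemma mono_or_rainbow (T U : eqType) (f : T -> U) p d (s : seq T) :
  p.+1 * d <= size s ->
  (exists g s', [/\ subseq s' s, p < size s' & all (fun x => f x == g) s']) \/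
  (exists s', [/\ subseq s' s, size s' = d & uniq (map f s')]).
Proof.
elim: d s => [|d IH] [|x s] hs; try by (right; exists [::]).
have [le|gt] := ltnP p (size [seq y <- x :: s | f y == f x]).
  left; exists (f x), [seq y <- x :: s | f y == f x]; split=> //.
    exact: filter_subseq.
  by apply/allP => y; rewrite mem_filter => /andP[].
have := count_predC (fun y => f y == f x) (x :: s).
rewrite -!size_filter => hc.
have hx : [seq y <- x :: s | predC (fun y => f y == f x) y] =
          [seq y <- s | f y != f x] by rewrite /= eqxx.
rewrite hx in hc.
have /IH[[g [s' [h1 h2 h3]]]|[s' [h1 h2 h3]]] :
    p.+1 * d <= size [seq y <- s | f y != f x].
  by move: hs hc gt; rewrite mulnS; lia.
- left; exists g, s'; split=> //.
  apply: subseq_trans h1 (subseq_trans (filter_subseq _ _) (subseq_cons _ _)).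
- right; exists (x :: s'); split.
  + by rewrite /= eqxx (subseq_trans h1) ?filter_subseq.
  + by rewrite /= h2.
  + rewrite /= h3 andbT; apply/negP => /mapP[y /(mem_subseq h1)].
    by rewrite mem_filter => /andP[/eqP hy _] e; apply: hy.
Qed.

(** A union bound over [r]. *)
Lemma count_avoid (T U : eqType) (P : U -> pred T) p (r : seq U) (s : seq T) :
  (exists2 u, u \in r & p <= count (P u) s) \/
  size s <= count (fun x => all (fun u => ~~ P u x) r) s + p * size r.
Proof.
elim: r => [|u r [[v hv hp]|IH]]; first by right; rewrite count_predT leq_addr.
  by left; exists v => //; rewrite in_cons hv orbT.
have [le|gt] := leqP p (count (P u) s).
  by left; exists u => //; rewrite mem_head.
right; rewrite mulnS addnCA (leq_trans IH) // addnA leq_add2r.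
apply: leq_trans (leq_add (ltnW gt) (leqnn _)).
rewrite -count_predUI; apply: leq_trans (leq_addr _ _).
by apply: sub_count => x /= ->; case: (P u x).
Qed.

(* Iterating a step that passes to a large part of the remaining list on which
   a label of the head describes all its later neighbours. *)
Lemma end_homogeneous (T L : eqType) (Q : L -> T -> pred T) (h : nat -> nat)
    (s0 : seq T) :
  (forall p u s, subseq (u :: s) s0 -> h p <= size s ->
     exists l s', [/\ subseq s' s, p <= size s' & all (Q l u) s']) ->
  forall t s, subseq s s0 -> iter t (fun p => (h p).+1) 0 <= size s ->
  exists w : seq (T * L), [/\ size w = t, subseq (unzip1 w) s
    & pairwise (fun a b => Q a.2 a.1 b.1) w].
Proof.
move=> step; elim=> [|t IH] s ss0 /= hs; first by exists [::]; rewrite sub0seq.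
case: s ss0 hs => [|u s] //= ss0 hs.
have [l [s' [h1 h2 h3]]] := step _ _ _ ss0 hs.
have [|w [hw1 hw2 hw3]] := IH s' _ h2.
  by apply: subseq_trans h1 (subseq_trans (subseq_cons _ _) ss0).
exists ((u, l) :: w); split; rewrite /= ?hw1 //.
  by rewrite eqxx (subseq_trans hw2).
rewrite hw3 andbT; apply/allP => a /(map_f fst)/(mem_subseq hw2).
by move/(allP h3).
Qed.

(* Either some point has [p] preimages, which are independent, or greedy
   selection works. *)
Lemma independent_set (T : eqType) (f : T -> T) p (s : seq T) :
  (forall x, f x != x) -> uniq s -> p.+1 * p <= size s ->
  exists s', [/\ subseq s' s, size s' = p & {in s', forall x, f x \notin s'}].
Proof.
move=> ff us hs.
suff H d s1 : subseq s1 s -> p.+1 * d <= size s1 ->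
  (exists s', [/\ subseq s' s, size s' = p & {in s', forall x, f x \notin s'}])
  \/ (exists s', [/\ subseq s' s1, size s' = d
        & {in s', forall x, f x \notin s'}]).
  by have [] := H p s (subseq_refl s) hs.
elim: d s1 => [|d IH] [|u s1] ss1 h1; try by (right; exists [::]).
have s1s := subseq_trans (subseq_cons s1 u) ss1.
have /andP[us1 _] := subseq_uniq ss1 us.
pose a := [pred x | f x == u].
have [le|gt] := leqP p (count a s1).
  (* These points are all sent to [u], which [uniq] keeps out of [s1]. *)
  left; exists (take p [seq x <- s1 | a x]); split.
  - apply: subseq_trans (take_subseq _ _) (subseq_trans _ s1s).
    exact: filter_subseq.
  - by rewrite size_takel // size_filter.
  - move=> x /mem_take; rewrite mem_filter => /andP[/eqP -> _].
    by apply/negP => /mem_take; rewrite mem_filter (negPf us1) andbF.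
(* Choosing [u] excludes fewer than [p] preimages and the single point [f u]. *)
pose s2 := [seq x <- s1 | ~~ a x & x != f u].
have hs2 : p.+1 * d <= size s2.
  have hu : count (pred1 (f u)) s1 <= 1.
    by rewrite count_uniq_mem ?leq_b1 // (subseq_uniq s1s us).
  have : size s1 <= count a s1 + (count (pred1 (f u)) s1 + size s2).
    rewrite size_filter.
    have -> : size s1 = count (predU a (predU (pred1 (f u))
        (fun x => ~~ a x && (x != f u)))) s1.
      rewrite -count_predT; apply: eq_count => x /=.
      by case: (f x == u); case: (x == f u).
    have := count_predUI a (predU (pred1 (f u))
      (fun x => ~~ a x && (x != f u))) s1.
    have := count_predUI (pred1 (f u)) (fun x => ~~ a x && (x != f u)) s1.
    lia.
  by move: h1; rewrite mulnS /=; lia.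
have s2s1 : subseq s2 s1 by apply: filter_subseq.
have [//||[s' [k1 k2 k3]]] := IH s2 _ hs2; first exact: subseq_trans s2s1 s1s.
  by left.
right; exists (u :: s'); split; rewrite /= ?k2 //.
  by rewrite eqxx (subseq_trans k1).
move=> x; rewrite !inE negb_or => /orP[/eqP ->|xs'].
  rewrite ff /=; apply/negP => /(mem_subseq k1).
  by rewrite mem_filter eqxx andbF.
rewrite k3 // andbT.
by move/(mem_subseq k1): xs'; rewrite mem_filter => /andP[/andP[]].
Qed.

(** * Colour counts of finite cliques, and cliques that realise every small count *)

Section Colours.

Variables (V K : eqType) (c : V -> V -> K).
Hypothesis csym : forall x y, c x y = c y x.

(** Multiplicities are kept, so that [uniq (pair_colours s)] expresses a rainbow clique. *)
Fixpoint pair_colours (s : seq V) : seq K :=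
  if s is x :: s' then map (c x) s' ++ pair_colours s' else [::].

Definition ncol s := size (undup (pair_colours s)).

Definition exactly m := exists2 s, uniq s & ncol s = m.

Lemma pair_coloursP s g : uniq s ->
  reflect (exists x y, [/\ x \in s, y \in s, x != y & g = c x y])
          (g \in pair_colours s).
Proof.
move=> us; apply: (iffP idP).
  elim: s us => //= x s IH /andP[xs us]; rewrite mem_cat => /orP[].
    case/mapP => y ys ->; exists x, y; rewrite !inE eqxx ys orbT; split=> //.
    by apply: contraNneq xs => ->.
  by case/(IH us) => y [z [ys zs yz ->]]; exists y, z; rewrite !inE ys zs !orbT.
case=> y [z []]; elim: s us => //= x s IH /andP[xs us].
rewrite !inE mem_cat => /predU1P[->|ys] /predU1P[->|zs] yz gE.
- by rewrite eqxx in yz.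
- by rewrite gE map_f.
- by rewrite gE csym map_f.
- by rewrite IH ?orbT.
Qed.

Lemma size_pair_colours s : size (pair_colours s) = 'C(size s, 2).
Proof.
by elim: s => //= x s IH; rewrite size_cat size_map IH binS bin1 addnC.
Qed.

Lemma subseq_pair_colours s1 s2 :
  subseq s1 s2 -> subseq (pair_colours s1) (pair_colours s2).
Proof.
elim: s2 s1 => [|y s2 IH] [|x s1] //=; first by rewrite sub0seq.
case: eqP => [-> h|_ h]; first by rewrite cat_subseq ?map_subseq ?IH.
by apply: subseq_trans (IH _ h) (suffix_subseq _ _).
Qed.

Lemma ncol_rainbow s : uniq (pair_colours s) -> ncol s = 'C(size s, 2).
Proof. by move=> h; rewrite /ncol undup_id // size_pair_colours. Qed.

Lemma ncol_le s l : {subset pair_colours s <= l} -> ncol s <= size l.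
Proof.
move=> h; apply: uniq_leq_size (undup_uniq _) _ => g.
by rewrite mem_undup => /h.
Qed.

Lemma ncol_ge s l : uniq l -> {subset l <= pair_colours s} -> size l <= ncol s.
Proof. by move=> ul h; apply: uniq_leq_size ul _ => g /h; rewrite mem_undup. Qed.

Lemma ncol_cons x s g :
  {subset map (c x) s <= g :: pair_colours s} -> ncol (x :: s) <= (ncol s).+1.
Proof.
move=> h; apply: (@leq_trans (size (g :: undup (pair_colours s)))) => //.
apply: ncol_le => u /=; rewrite inE mem_undup mem_cat => /orP[/h|->].
  by rewrite inE.
by rewrite orbT.
Qed.

(* A discrete intermediate value theorem: if vertices can be added so that each
   creates at most one new colour, no number of colours is skipped. *)
Lemma exactly_between (T : Type) (f : T -> V) m (w : seq T) s0 :
  (forall w1 x w2, w = w1 ++ x :: w2 -> let s := map f w2 ++ s0 in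
     exists g, {subset map (c (f x)) s <= g :: pair_colours s}) ->
  uniq (map f w ++ s0) -> ncol s0 <= m <= ncol (map f w ++ s0) -> exactly m.
Proof.
elim: w => [|x w IH] step us hm.
  by exists s0 => //; apply/eqP; rewrite eqn_leq.
have [le|gt] := leqP m (ncol (map f w ++ s0)).
  apply: IH; last by case/andP: hm => ->.
    by move=> w1 y w2 E; apply: (step (x :: w1)); rewrite E.
  by case/andP: us.
have [g /ncol_cons hg] := step [::] x w erefl.
exists (map f (x :: w) ++ s0) => //; apply/eqP; rewrite eqn_leq (leq_trans hg) //.
by case/andP: hm.
Qed.

(** Vertices are added from the end of [w], each bringing only its label. The last label need not
    occur on an edge, so [size w - 1] colours are guaranteed. *)
Lemma exactly_of_min_coloured m (w : seq (V * K)) :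
  uniq (unzip1 w) -> uniq (unzip2 w) ->
  pairwise (fun a b => c a.1 b.1 == a.2) w -> m < size w -> exactly m.
Proof.
move=> u1 u2 pw mw; apply: (@exactly_between _ fst m w [::]).
- move=> w1 x w2 E; exists x.2 => g; rewrite cats0 -map_comp => /mapP[y yw2 ->].
  move: pw; rewrite E pairwise_cat => /and3P[_ _ /andP[/allP/(_ _ yw2)/eqP /= -> _]].
  exact: mem_head.
- by rewrite cats0.
- rewrite cats0 /=; case: w u1 u2 pw mw => // x w u1 u2 pw mw.
  apply: (@leq_trans (size (unzip2 (belast x w)))).
    by rewrite size_map size_belast.
  have uu : uniq (unzip2 (belast x w)).
    apply: subseq_uniq u2; apply: map_subseq.
    by rewrite [x :: w]lastI subseq_rcons.
  apply: ncol_ge => // g.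
  elim: w x {mw uu u1 u2} pw => //= y w IH x /andP[/andP[/eqP e _] /IH h].
  rewrite inE => /predU1P[->|/h hg]; first by rewrite inE e eqxx.
  rewrite inE mem_cat; apply/orP; right; apply/orP; right; exact: hg.
Qed.

(** Reversing the list reduces this to labels on first endpoints. *)
Lemma exactly_of_max_coloured m (f : V -> K) s :
  uniq s -> uniq (map f s) -> pairwise (fun x y => c x y == f y) s ->
  m < size s -> exactly m.
Proof.
move=> us uf ps ms.
apply: (@exactly_of_min_coloured m [seq (x, f x) | x <- rev s]).
- by rewrite /unzip1 -map_comp map_id rev_uniq.
- by rewrite /unzip2 -map_comp map_rev rev_uniq.
- rewrite pairwise_map; elim: s ps {us uf ms} => //= x s IH /andP[/allP h /IH h2].
  rewrite rev_cons pairwise_rcons h2 andbT; apply/allP => y.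
  by rewrite mem_rev => /h; rewrite csym.
- by rewrite size_map size_rev.
Qed.

(** The start is the triangle on [r] and two vertices of [s], with at most three colours, whence
    [2 < m]. It contains [g], so a further vertex brings only its colour to [r]. *)
Lemma exactly_of_mono_star m r g s :
  uniq (r :: s) -> uniq (map (c r) s) -> pairwise (fun x y => c x y == g) s ->
  2 < m <= size s -> exactly m.
Proof.
move=> us uf ps /andP[m2 ms].
have {s us uf ps ms} [a [b [s]]] : exists a b s', [/\ uniq (r :: s' ++ [:: a; b]),
    uniq (map (c r) (s' ++ [:: a; b])),
    pairwise (fun x y => c x y == g) (s' ++ [:: a; b]) &
    m <= size (s' ++ [:: a; b])].
  case/lastP: s us uf ps ms => [|s b] us uf ps ms; first by move: ms => /=; lia.
  case/lastP: s us uf ps ms => [|s a] us uf ps ms; first by move: ms => /=; lia.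
  by exists a, b, s; rewrite -cat_rcons cats1.
rewrite pairwise_cat => -[us uf /and3P[/allrelP pr ps /= /andP[/andP[/eqP ab _] _]] ms].
have up : uniq (s ++ [:: a; b; r]).
  rewrite (_ : _ ++ _ = rcons (s ++ [:: a; b]) r) ?rcons_uniq //.
  by rewrite -cats1 -catA.
apply: (@exactly_between _ id m s [:: a; b; r]).
- move=> s1 x s2 E /=; exists (c x r) => h; rewrite map_id => /mapP[y].
  have xs : x \in s by rewrite E mem_cat mem_head orbT.
  have gin : g \in pair_colours (s2 ++ [:: a; b; r]).
    apply: (mem_subseq (subseq_pair_colours (suffix_subseq _ _))).
    by rewrite /= inE ab eqxx.
  rewrite mem_cat !inE => /or4P[ys2|/eqP->|/eqP->|/eqP->] ->; rewrite ?eqxx //.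
  + move: ps; rewrite E pairwise_cat /= => /and4P[_ _ /allP/(_ _ ys2)/eqP -> _].
    by rewrite gin orbT.
  + have /eqP -> : c x a == g by apply: pr; rewrite // mem_head.
    by rewrite gin orbT.
  + have /eqP -> : c x b == g by apply: pr; rewrite // !inE eqxx orbT.
    by rewrite gin orbT.
- by rewrite map_id.
- rewrite map_id; apply/andP; split.
    by apply: (@leq_trans 3) => //; apply: size_undup.
  apply: leq_trans ms _; rewrite -(size_map (c r)); apply: ncol_ge => // h.
  case/mapP => x xs ->; apply/pair_coloursP => //; exists r, x.
  have rs : r \notin s ++ [:: a; b] by case/andP: us.
  split=> //; first by rewrite mem_cat !inE eqxx !orbT.
    by move: xs; rewrite !mem_cat !inE => /or3P[]->; rewrite ?orbT.
  by apply: contraNneq rs => ->.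
Qed.

End Colours.

(** * Canonical Ramsey argument around a vertex that sees many colours *)

Section Fans.

Variables V K : eqType.
Implicit Type c : V -> V -> K.

(* The last two conditions say that adding any single vertex of [s] keeps the
   clique [r] rainbow. *)
Definition fan c (r s : seq V) :=
  [/\ uniq (r ++ s), uniq (pair_colours c r),
      {in r, forall y, uniq (map (c y) s)},
      {in s, forall x, uniq (map (c^~ x) r)} &
      {in r & s, forall y x, c y x \notin pair_colours c r}].

Lemma fan_subseq c r s s' : subseq s' s -> fan c r s -> fan c r s'.
Proof.
move=> ss [h1 h2 h3 h4 h5]; split=> //.
- by apply: subseq_uniq h1; rewrite subseq_cat2l.
- by move=> y /h3; apply: subseq_uniq; apply: map_subseq.
- by move=> x /(mem_subseq ss)/h4.
- by move=> y x yr /(mem_subseq ss); apply: h5.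
Qed.

Lemma fan_cons c r u s :
  (forall x y, c x y = c y x) -> fan c r (u :: s) -> uniq (map (c u) s) ->
  {in r & s, forall y x, c u x != c y x} ->
  {in u :: r & s, forall y x, c y x \notin pair_colours c (u :: r)} ->
  fan c (u :: r) s.
Proof.
move=> csym [h1 h2 h3 h4 h5] hu hne hnew; split=> //.
- by move: h1; rewrite -(cat1s u s) uniq_catCA.
- rewrite /= cat_uniq h2 andbT (eq_map (csym u)) h4 ?mem_head //=.
  apply/hasPn => g gr; apply/negP => /mapP[y yr gE].
  by move: (h5 y u yr (mem_head _ _)); rewrite -gE gr.
- move=> y; rewrite inE => /predU1P[->//|/h3 /=]; by case/andP.
- move=> x xs /=; rewrite h4 ?inE ?xs ?orbT // andbT.
  by apply/negP => /mapP[y yr /eqP]; rewrite (negPf (hne _ _ yr xs)).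
Qed.

(** If [u] repeats no colour often and seldom agrees with a vertex of [r], discarding the few bad
    vertices lets [u] join the clique. *)
Lemma fan_extend c r u s p t :
  (forall x y, c x y = c y x) -> fan c r (u :: s) ->
  let n := size r in
  p.+1 * (p.+1 * n + ('C(n.+1, 2).+1 * n.+1 + t)) <= size s ->
  [\/ exists g s', [/\ subseq s' s, p <= size s' & all (fun x => c u x == g) s'],
      exists y s', [/\ subseq s' s, p <= size s',
        y \in r & all (fun x => c u x == c y x) s'] |
      exists2 s', fan c (u :: r) s' & t <= size s'].
Proof.
move=> csym hf n /(mono_or_rainbow (c u)).
case=> [[g [s' [h1 /ltnW h2 h3]]]|[s1 [h1 h2 h3]]]; first by apply: Or31; exists g, s'.
case: (count_avoid (fun y x => c u x == c y x) p r s1) => [[y yr yp]|hr].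
  apply: Or32; exists y, [seq x <- s1 | c u x == c y x]; split=> //.
  - exact: subseq_trans (filter_subseq _ _) h1.
  - by rewrite size_filter.
  - by apply/allP => x; rewrite mem_filter => /andP[].
pose s2 := [seq x <- s1 | all (fun y => c u x != c y x) r].
have s2s1 : subseq s2 s1 by apply: filter_subseq.
have us2 : uniq (map (c u) s2) by apply: subseq_uniq h3; apply: map_subseq.
have fs2 : fan c r (u :: s2).
  by apply: fan_subseq hf; rewrite /= eqxx (subseq_trans s2s1).
(* Every [y] in [u :: r] sees [s2] in distinct colours, so at most as many vertices are bad for [y]
   as [u :: r] has edges. *)
case: (count_avoid (fun y x => c y x \in pair_colours c (u :: r))
    'C(n.+1, 2).+1 (u :: r) s2) => [[y yr]|hr2].
  rewrite -size_filter -(size_map (c y)) => /leq_trans h; exfalso.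
  have /h : size [seq c y i | i <- s2 & c y i \in pair_colours c (u :: r)] <=
      'C(n.+1, 2).
    rewrite -[n.+1]/(size (u :: r)) -(size_pair_colours c).
    apply: uniq_leq_size => [|g /mapP[x]].
      apply: (@subseq_uniq _ _ (map (c y) s2)).
        by apply: map_subseq; apply: filter_subseq.
      move: yr; rewrite inE => /predU1P[->//|yr].
      by case: fs2 => _ _ /(_ y yr) /andP[].
    by rewrite mem_filter => /andP[? _] ->.
  by rewrite ltnn.
apply: Or33.
exists [seq x <- s2 | all (fun y => c y x \notin pair_colours c (u :: r)) (u :: r)].
  apply: fan_cons => //.
  - by apply: fan_subseq fs2; rewrite /= eqxx filter_subseq.
  - by apply: subseq_uniq us2; apply: map_subseq; apply: filter_subseq.
  - by move=> y x yr; rewrite !mem_filter => /and3P[_ /allP/(_ _ yr)].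
  - by move=> y x yr; rewrite mem_filter => /andP[/allP/(_ _ yr)].
rewrite size_filter; move: hr hr2; rewrite -size_filter -/s2 h2 /=; nia.
Qed.

(** Induction on the number [d] of vertices missing from the rainbow clique. If no vertex can join,
    the obstructions are recorded as labels, and a homogeneous sequence of them gives one of the
    three structures with one new colour per vertex. *)
Lemma rainbow_or_exactly_of_fan N m d : 2 < m -> exists t, forall c,
  (forall x y, c x y = c y x) -> forall r s,
  0 < size r -> size r + d = N -> fan c r s -> t <= size s ->
  (exists q, [/\ uniq q, size q = N & uniq (pair_colours c q)]) \/ exactly c m.
Proof.
move=> m2; elim: d => [|d [t IH]].
  exists 0 => c csym r s _ <- [h1 h2 _ _ _] _; left; exists r; split=> //.
    by move: h1; rewrite cat_uniq => /andP[].
  by rewrite addn0.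
pose h p := p.+1 * (p.+1 * N + ('C(N, 2).+1 * N + t)).
(* Enough for a final pigeonhole giving [m.+1] equal or [m.+1] distinct colours. *)
pose q := m.+1 * m.+1.
exists (iter (q.+1 * N.+2) (fun p => (h p).+1) 0) => c csym r s r0 rN fs hs.
apply: contrapT => nG.
(* The label of [u] is a vertex of [r] with which it agrees, or its constant colour. *)
pose Q (l : V + K) u x :=
  match l with inl y => (y \in r) && (c u x == c y x) | inr g => c u x == g end.
have [p u s1 ss1 hp|w [w1 w2 w3]] := end_homogeneous (Q := Q) _ (subseq_refl s) hs.
  have fu := fan_subseq ss1 fs.
  case: (@fan_extend c r u s1 p t csym fu _).
  - apply: leq_trans hp; rewrite /h leq_mul2l /=.
    have rN' : (size r).+1 <= N by lia.
    by rewrite leq_add ?leq_add2r ?leq_mul ?ltnS ?leq_bin2l //; exact: ltnW.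
  - by case=> g [s' [? ? ?]]; exists (inr g), s'.
  - case=> y [s' [? ? yr ys]]; exists (inl y), s'; split=> //.
    by apply: sub_all ys => x /=; rewrite yr.
  - by case=> s' fs' ts'; case: nG; apply: IH fs' ts'; rewrite //= -rN; lia.
have [us _ hr _ _] := fs.
have {}us : uniq s by move: us; rewrite cat_uniq => /and3P[].
pose lab (a : V * (V + K)) := if a.2 is inl y then
  if y \in r then Some y else None else None.
have := @mono_or_rainbow _ _ lab q N.+2 w; rewrite w1 => /(_ (leqnn _)).
case=> [[l [v [v1 v2 v3]]]|[v [v1 v2 v3]]]; last first.
  (* [lab] takes at most [size r + 1] values, fewer than [N.+2]. *)
  have : size (map lab v) <= size (None :: map Some r).
    apply: uniq_leq_size => // o /mapP[[a [y|g]] _ ->]; rewrite /lab //=.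
    by case: ifP => // yr; rewrite inE map_f.
  rewrite /= !size_map v2 -rN => /ltnW; rewrite !ltnS; lia.
have wv : subseq (unzip1 v) s by apply: subseq_trans w2; apply: map_subseq.
have uv := subseq_uniq wv us.
have pv := subseq_pairwise v1 w3.
(* For [Some y], an edge has the colour [c y x] of its later endpoint [x], and [y] sees [s] in
   distinct colours. *)
case: l v3 => [y|] v3; apply: nG; right.
  case: v v2 v3 {v1} wv uv pv => // a v v2 v3 wv uv pv.
  have labE b : b \in a :: v -> y \in r /\ b.2 = inl y.
    by move/(allP v3); rewrite /lab; case: b.2 => // z; case: ifP => // zr /eqP[<-].
  apply: (@exactly_of_max_coloured _ _ c csym m (c y) (unzip1 (a :: v))) => //.
  - have yr := (labE _ (mem_head _ _)).1.
    by apply: subseq_uniq (hr _ yr); apply: map_subseq.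
  - rewrite pairwise_map; apply: (sub_in_pairwise (P := mem (a :: v))) pv.
      by move=> b e /labE[_ bE] _ /=; rewrite /Q bE => /andP[].
    exact/allP.
  - by rewrite size_map; apply: leq_trans v2; rewrite /q ltnS; nia.
(* For [None], edges are coloured by their earlier endpoint; the last vertex [z] is set aside so
   that the colour belonging to [x] is [c x z]. *)
case/lastP: v v2 v3 {v1} wv uv pv => // v z v2 v3.
rewrite /unzip1 map_rcons => wv; rewrite rcons_uniq => /andP[_ uv].
rewrite pairwise_rcons => /andP[/allP vz pv].
have labE b : b \in v -> b.2 = inr (c b.1 z.1).
  move=> bv; have := vz _ bv.
  have := allP v3 b; rewrite mem_rcons inE bv orbT /lab => /(_ isT).
  by case: b.2 => [y|g]; rewrite /Q; [case: (y \in r) | move=> _ /eqP ->].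
have {}pv : pairwise (fun x y => c x y == c x z.1) (unzip1 v).
  rewrite pairwise_map; apply: (sub_in_pairwise (P := mem v)) pv.
    by move=> b e /labE bE _ /=; rewrite /Q bE.
  exact/allP.
have qv : q <= size (unzip1 v) by rewrite size_map; move: v2; rewrite size_rcons.
have {}wv : subseq (unzip1 v) s.
  by apply: subseq_trans wv; apply: subseq_rcons.
(* Equal colours give a monochromatic clique with apex in [r]; distinct ones a clique coloured by
   first endpoints. *)
case: (mono_or_rainbow (c^~ z.1) qv) => [[g [s' [h1 h2 h3]]]|[s' [h1 h2 h3]]].
  have s's := subseq_trans h1 wv.
  case: r r0 {rN v3 lab Q w3 vz} fs hr => // y r _ fs hr.
  apply: (@exactly_of_mono_star _ _ c csym m y g s').
  - rewrite /= (subseq_uniq s's us) andbT.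
    have [+ _ _ _ _] := fan_subseq s's fs.
    by rewrite cons_uniq mem_cat negb_or -andbA => /and3P[].
  - by apply: subseq_uniq (hr _ (mem_head _ _)); apply: map_subseq.
  - apply: (sub_in_pairwise (P := mem s')) (subseq_pairwise h1 pv).
      by move=> a b /(allP h3)/= /eqP -> _.
    exact/allP.
  - by rewrite m2 ltnW.
apply: (@exactly_of_min_coloured _ _ c m [seq (x, c x z.1) | x <- s']).
- by rewrite /unzip1 -map_comp map_id (subseq_uniq h1).
- by rewrite /unzip2 -map_comp.
- by rewrite pairwise_map; apply: subseq_pairwise h1 pv.
- by rewrite size_map h2.
Qed.

End Fans.

(** * Rainbow matchings when every vertex sees few colours *)

Section Matchings.

Variables (V K : eqType) (c : V -> V -> K).
Hypothesis csym : forall x y, c x y = c y x.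

Definition disjoint_edges (a b : V * V) :=
  all (fun v => (b.1 != v) && (b.2 != v)) [:: a.1; a.2].

Definition cross_colours (a b : V * V) :=
  [:: c a.1 b.1; c a.2 b.2; c a.1 b.2; c a.2 b.1].

Lemma uniq_matching (w : seq (V * V)) : all (fun e => e.1 != e.2) w ->
  pairwise disjoint_edges w -> uniq (unzip2 w ++ unzip1 w).
Proof.
elim: w => // a w IH /andP[an /IH uw] /andP[/allP da /uw{}uw].
rewrite /unzip1 map_cons -[a.1 :: _]cat1s uniq_catCA /= inE uw andbT !mem_cat !negb_or an.
rewrite -!andbA /=; apply/and4P; split; apply/negP => /mapP[b /da];
  by case/and3P => /andP[/eqP ? /eqP ?] /andP[/eqP ? /eqP ?] _ ?; auto.
Qed.

(** The first edge [e] and the last two [a], [b] are set aside, hence the [3]. The start, [a.2],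
    [b.2] and the first endpoints of the rest, has at most three colours. Adding [e.2] brings at
    most the mixed colour [c a.2 b.1]; after that each second endpoint brings at most the colour of
    its own edge. *)
Lemma exactly_of_homogeneous_matching m l (w : seq (V * V)) :
  all (fun e => e.1 != e.2) w -> uniq [seq c e.1 e.2 | e <- w] ->
  pairwise (fun a b => disjoint_edges a b && (cross_colours a b == l)) w ->
  2 < m -> m + 3 <= size w -> exactly c m.
Proof.
case: w => [|e w]; first by rewrite addnC.
case/lastP: w => [|w b]; first by rewrite addnC.
case/lastP: w => [|w a]; first by rewrite addnC.
rewrite -cats1 cat_rcons => we wc wp m2; rewrite /= size_cat /= => hm.
have mw : m <= size w by lia.
have uw : uniq (map snd (rcons w e) ++ a.2 :: b.2 :: map fst w).
  have : uniq (unzip2 (e :: w ++ [:: a; b]) ++ unzip1 (e :: w ++ [:: a; b])).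
    by apply: uniq_matching we _; apply: sub_pairwise wp => x y /andP[].
  rewrite /unzip1 /unzip2 !map_cons !map_cat cat_cons -catA.
  rewrite -[e.2 :: _]cat1s uniq_catCA.
  apply: subseq_uniq; rewrite map_rcons cat_rcons subseq_cat2l /= !eqxx.
  by apply: subseq_trans (prefix_subseq _ _) (subseq_cons _ _).
move: wp; rewrite pairwise_cons pairwise_cat all_cat pairwise2.
case/andP => /andP[/allP ew /and3P[ea eb _]] /and3P[wab ww ab].
have lE : l = cross_colours a b by case/andP: ab => _ /eqP ->.
have cE x y : disjoint_edges x y && (cross_colours x y == l) ->
  [/\ c x.1 y.1 = c a.1 b.1, c x.2 y.2 = c a.2 b.2, c x.1 y.2 = c a.1 b.2
    & c x.2 y.1 = c a.2 b.1] by rewrite lE => /andP[_ /eqP[]].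
have wa x : x \in w -> c x.1 a.2 = c a.1 b.2 /\ c x.2 a.2 = c a.2 b.2.
  by move=> xw; have [] := cE x a; first by apply: (allrelP wab); rewrite ?mem_head.
have wb x : x \in w -> c x.1 b.2 = c a.1 b.2 /\ c x.2 b.2 = c a.2 b.2.
  move=> xw; have [] := cE x b; last by [].
  by apply: (allrelP wab); rewrite // !inE eqxx orbT.
have we' x : x \in w -> c e.2 x.1 = c a.2 b.1 /\ c e.2 x.2 = c a.2 b.2.
  by move=> xw; have [] := cE e x; first by apply: ew.
pose s0 := a.2 :: b.2 :: map fst w.
have Bs0 : c a.2 b.2 \in pair_colours c s0 by rewrite mem_head.
apply: (@exactly_between _ _ c _ snd m (rcons w e) s0) => //.
- move=> w1 x w2 E s; rewrite {}/s.
  (* As the end of [rcons w e], [e.2] is added first; since [e] precedes [w] in the matching, it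
     meets all first endpoints in one colour. *)
  case/lastP: w2 E => [|w2 x'].
    rewrite cats1 => /rcons_inj[_ <-]; exists (c a.2 b.1) => g.
    rewrite /= !inE => /or3P[/eqP->|/eqP->|].
    + by have [_ -> _ _] := cE e a ea; rewrite eqxx orbT.
    + by have [_ -> _ _] := cE e b eb; rewrite eqxx orbT.
    + by case/mapP => _ /mapP[y yw ->] ->; rewrite (we' _ yw).1 eqxx.
  rewrite -rcons_cons -rcons_cat => /rcons_inj[wE <-]; exists (c x.1 x.2) => g.
  have xw : x \in w by rewrite wE mem_cat mem_head orbT.
  have s0s : subseq s0 (map snd (rcons w2 e) ++ s0) by apply: suffix_subseq.
  have {}Bs0 := mem_subseq (subseq_pair_colours c s0s) Bs0.
  (* Both mixed colours are already present, on the edge from [x.1] to [a.2] and on that from [e.2]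
     to [x.1]. *)
  have Cs0 : c a.1 b.2 \in pair_colours c (map snd (rcons w2 e) ++ s0).
    apply: (mem_subseq (subseq_pair_colours c s0s)); rewrite /= inE mem_cat.
    by rewrite -(wa _ xw).1 csym map_f ?orbT // map_f.
  have Ds0 : c a.2 b.1 \in pair_colours c (map snd (rcons w2 e) ++ s0).
    rewrite map_rcons cat_rcons.
    apply: (mem_subseq (subseq_pair_colours c (suffix_subseq _ _))).
    by rewrite /= !inE mem_cat -(we' _ xw).1 map_f ?orbT // map_f.
  move: ww; rewrite wE pairwise_cat => /and3P[/allrelP w12 _ /= /andP[/allP w2x _]].
  case/mapP => v; rewrite {1}map_rcons mem_cat mem_rcons !inE => + ->.
  case/orP => [/predU1P[->|/mapP[y yw ->]]|/or3P[/eqP->|/eqP->|/mapP[y]]].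
  + by rewrite csym (we' _ xw).2 Bs0 orbT.
  + by have [_ -> _ _] := cE x y (w2x _ yw); rewrite Bs0 orbT.
  + by rewrite (wa _ xw).2 Bs0 orbT.
  + by rewrite (wb _ xw).2 Bs0 orbT.
  + rewrite wE mem_cat inE => /or3P[yw|/eqP->|yw] ->.
    * by have [_ _ + _] := cE y x (w12 _ _ yw (mem_head _ _));
        rewrite csym => ->; rewrite Cs0 orbT.
    * by rewrite csym eqxx.
    * by have [_ _ _ ->] := cE x y (w2x _ yw); rewrite Ds0 orbT.
- apply/andP; split.
    apply: (@leq_trans 3) => //.
    rewrite (_ : 3 = size [:: c a.2 b.2; c a.1 b.2; c a.1 b.1]) //.
    apply: ncol_le => g; rewrite /= !inE !mem_cat.
    case/or4P => [->//|/mapP[_ /mapP[x xw ->] ->]|/mapP[_ /mapP[x xw ->] ->]|].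
    + by rewrite csym (wa _ xw).1 eqxx orbT.
    + by rewrite csym (wb _ xw).1 eqxx orbT.
    + elim: (w) ww => //= x v IH /andP[/allP h1 /IH h2]; rewrite mem_cat.
      case/orP => [/mapP[_ /mapP[y yv ->] ->]|/h2//].
      by have [-> _ _ _] := cE x y (h1 _ yv); rewrite eqxx !orbT.
  apply: leq_trans mw _; rewrite -(size_map (fun e => c e.1 e.2)); apply: ncol_ge.
    by apply: subseq_uniq wc; apply: map_subseq;
      apply: subseq_trans (prefix_subseq _ _) (subseq_cons _ _).
  move=> g /mapP[x xw ->]; apply/pair_coloursP => //; exists x.1, x.2; split=> //.
  + by rewrite mem_cat !inE (map_f fst) ?orbT.
  + by rewrite mem_cat map_f // mem_rcons inE xw orbT.
  + by apply: (allP we); rewrite inE mem_cat xw orbT.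
Qed.

Section BoundedStars.

Variable D : nat.
Hypothesis bounded_stars :
  forall v s, v \notin s -> uniq (map (c v) s) -> size s < D.

(** One pigeonhole per member of [l]; its rainbow outcome would be a star with [D] distinct
    colours. *)
Lemma bounded_stars_mono (l : seq (V * (V * V -> V))) p (s : seq (V * V)) :
  {in s, forall e, all (fun q => q.2 e != q.1) l} ->
  iter (size l) (fun p => p.+1 * D) p <= size s ->
  exists g s', [/\ subseq s' s, p <= size s' &
    all (fun e => [seq c q.1 (q.2 e) | q <- l] == g) s'].
Proof.
elim: l s => [|[v f] l IH] s /= hs ps; first by exists [::], s; split=> //; apply/allP.
have [[g [s1 [h1 /ltnW h2 h3]]]|[s1 [h1 h2 h3]]] :=
    mono_or_rainbow (fun e => c v (f e)) ps; last first.
  suff : size (map f s1) < D by rewrite size_map h2 ltnn.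
  apply: (@bounded_stars v); last by rewrite -map_comp.
  by apply/negP => /mapP[e /(mem_subseq h1)/hs/andP[/eqP h _] /esym].
have [e /(mem_subseq h1)/hs/andP[]//|gs [s2 [k1 k2 k3]]] := IH s1 _ h2.
exists (g :: gs), s2; split=> //; first exact: subseq_trans h1.
apply/allP => e es2; rewrite eqseq_cons (allP k3) // andbT.
by apply: (allP h3); apply: (mem_subseq k1).
Qed.

(** The edges at [v] form a rainbow star, whose leaves [f] picks out. *)
Lemma count_incident (s : seq (V * V)) v : all (fun e => e.1 != e.2) s ->
  uniq [seq c e.1 e.2 | e <- s] ->
  count (fun e => ~~ ((e.1 != v) && (e.2 != v))) s < D.
Proof.
move=> sn su; pose f (e : V * V) := if e.1 == v then e.2 else e.1.
pose t := [seq e <- s | ~~ ((e.1 != v) && (e.2 != v))].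
have ft : {in t, forall e, c v (f e) = c e.1 e.2 /\ f e != v}.
  move=> e; rewrite mem_filter negb_and !negbK /f => /andP[+ /(allP sn)/= h].
  case: eqP => [E _|_ /eqP E]; rewrite -E; last by rewrite csym.
  by rewrite eq_sym.
rewrite -size_filter -(size_map f); apply: (@bounded_stars v).
  by apply/negP => /mapP[e /ft[_ /eqP h] E]; apply: h.
have -> : map (c v) (map f t) = [seq c e.1 e.2 | e <- t].
  by rewrite -map_comp; apply/eq_in_map => e /ft[].
by apply: subseq_uniq su; apply: map_subseq; apply: filter_subseq.
Qed.

End BoundedStars.

End Matchings.

(** Few edges meet a given one, and its four cross colours to later edges can be made constant.
    Comparison with a last edge then makes them the same for all edges. *)
Lemma exactly_of_bounded_stars (V K : eqType) m D : 2 < m ->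
  exists t, forall c : V -> V -> K, (forall x y, c x y = c y x) ->
  (forall v s, v \notin s -> uniq (map (c v) s) -> size s < D) ->
  forall w : seq (V * V), all (fun e => e.1 != e.2) w ->
  uniq [seq c e.1 e.2 | e <- w] -> t <= size w -> exactly c m.
Proof.
move=> m2; pose i4 := iter 4 (fun p => p.+1 * D).
(* A round drops at most [D] edges per endpoint of the head and runs four pigeonholes; at the end
   one edge is the reference, and [m + 3] others must survive four more. *)
exists (iter (i4 (m + 3)).+1 (fun p => (D * 2 + i4 p).+1) 0).
move=> c csym bs w wn wu wt.
pose Q l a b := disjoint_edges a b && (cross_colours c a b == l).
have [p a s ss hp|v] := end_homogeneous (Q := Q) _ (subseq_refl w) wt.
  have sw : subseq s w := subseq_trans (subseq_cons s a) ss.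
  have sn : all (fun e => e.1 != e.2) s.
    by apply/allP => e /(mem_subseq sw)/(allP wn).
  have su : uniq [seq c e.1 e.2 | e <- s].
    by apply: subseq_uniq wu; apply: map_subseq.
  case: (count_avoid (fun v (e : V * V) => ~~ ((e.1 != v) && (e.2 != v))) D
      [:: a.1; a.2] s) => [[v _]|hc].
    by rewrite leqNgt (count_incident csym bs).
  pose s1 := [seq b <- s | disjoint_edges a b].
  have hs1 : i4 p <= size s1.
    rewrite size_filter; move: hc hp => /=.
    under eq_count do rewrite !negbK; rewrite -/(disjoint_edges a); lia.
  pose l := [:: (a.1, fst); (a.2, snd); (a.1, snd); (a.2, @fst V V)].
  have [e|g [s2 [k1 k2 k3]]] := bounded_stars_mono bs (l := l) _ hs1.
    by rewrite mem_filter => /andP[/and3P[/andP[? ?] /andP[? ?] _] _]; apply/and5P.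
  exists g, s2; split=> //; first exact: subseq_trans k1 (filter_subseq _ _).
  apply/allP => b bs2; rewrite /Q (allP k3 b bs2) andbT.
  by move/(mem_subseq k1): bs2; rewrite mem_filter => /andP[].
case/lastP: v => [[]//|v z]; rewrite size_rcons => -[[vs]].
rewrite /unzip1 map_rcons => vw; rewrite pairwise_rcons => /andP[/allP vz pv].
have {}vw := subseq_trans (subseq_rcons _ _) vw.
(* The cross colours of an edge to later ones equal those to [z], and the stars at the endpoints of
   [z] are bounded. *)
pose l := [:: (z.1.1, fst); (z.1.2, snd); (z.1.2, fst); (z.1.1, @snd V V)].
have {}vs : i4 (m + 3) <= size (map fst v) by rewrite size_map vs.
have [e /mapP[x /vz /andP[h _] ->]|g [s [k1 k2 k3]]] :=
    bounded_stars_mono bs (l := l) _ vs.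
  move: h; rewrite /disjoint_edges /= !(eq_sym z.1.1) !(eq_sym z.1.2).
  by do !case: (_ == _).
have sw := subseq_trans k1 vw.
apply: (exactly_of_homogeneous_matching csym (l := g) (w := s)) => //.
- by apply/allP => e /(mem_subseq sw)/(allP wn).
- by apply: subseq_uniq wu; apply: map_subseq.
apply: (sub_in_pairwise (P := mem s) (r := fun a b => disjoint_edges a b &&
    (cross_colours c a b == cross_colours c a z.1))).
- move=> a b as_ _ /andP[-> /eqP ->] /=; rewrite -(eqP (allP k3 a as_)).
  by rewrite /cross_colours !(csym a.1) !(csym a.2).
- exact/allP.
apply: subseq_pairwise k1 _; rewrite pairwise_map.
apply: (sub_in_pairwise (P := mem v)) pv; last exact/allP.
by move=> a b /vz /andP[_ /eqP <-] _.
Qed.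

(** * From rainbow cliques and twin vertices to exact counts *)

Lemma ncol_eq (V K : eqType) (c : V -> V -> K) s l :
  uniq l -> pair_colours c s =i l -> ncol c s = size l.
Proof.
move=> ul sl; apply/eqP; rewrite eqn_leq ncol_le ?ncol_ge // => g; by rewrite sl.
Qed.

(** The colour [g] lies on at most one edge, one endpoint of which differs from [x]. If [g] does not
    occur, [y] is the default. *)
Lemma rainbow_colour_endpoint (V K : eqType) (c : V -> V -> K) s g x y :
  x != y -> uniq s -> uniq (pair_colours c s) ->
  exists2 z, z != x & forall s', subseq s' s -> z \notin s' ->
    g \notin pair_colours c s'.
Proof.
move=> xy; elim: s => [|v s IH].
  by exists y; rewrite 1?eq_sym // => s'; rewrite subseq0 => /eqP ->.
case/andP => vs us; rewrite [pair_colours _ _]/= cat_uniq => /and3P[uv /hasPn dis up].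
have [/mapP[w ws gE]|ng] := boolP (g \in map (c v) s).
  have gs : g \notin pair_colours c s.
    by apply/negP => /dis; rewrite gE /= map_f.
  exists (if v == x then w else v).
    by case: ifP => [/eqP <-|/negbT //]; apply: contraNneq vs => <-.
  move=> [|u s'] //; case: (eqVneq u v) => [->|uv'] /=;
      rewrite ?eqxx ?(negPf uv') => ss.
    rewrite inE negb_or; case: ifP => _; rewrite ?eqxx // => /andP[_ ws'].
    rewrite /= mem_cat negb_or;
    apply/andP; split; last first.
      by apply: contra gs; apply: mem_subseq; apply: subseq_pair_colours.
    apply: contra ws' => /mapP[w' w's' E].
    have -> // : w = w'.
    have sub := mem_subseq ss w's'.
    by rewrite -(nth_index v ws) -(nth_index v sub);
      congr (nth v s _); apply/eqP;
      rewrite -(nth_uniq (c v v) _ _ uv) ?size_map ?index_mem //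
        !(nth_map v) ?index_mem // !nth_index // -gE E.
  move=> _; apply: contra gs; apply: mem_subseq; apply: subseq_pair_colours ss.
have [z zx hz] := IH us up; exists z => // -[|u s'] //.
case: (eqVneq u v) => [->|uv'] /=; rewrite ?eqxx ?(negPf uv') => ss;
  last exact: hz.
rewrite inE negb_or /= mem_cat negb_or => /andP[_ zs'].
rewrite hz // andbT; apply: contra ng; apply: mem_subseq; exact: map_subseq.
Qed.

Section Infinite.

Variables (K : eqType) (c : nat -> nat -> K) (l : seq K).
Hypothesis csym : forall x y, c x y = c y x.
Hypothesis cl : forall x y, x != y -> c x y \in l.

(** Beyond the maximum of [r] there are arbitrarily many vertices; one pigeonhole per vertex of [r],
    over the finitely many colours in [l], retains a large set. *)
Lemma twin_vertices (r : seq nat) : exists y z,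
  [/\ y != z, y \notin r, z \notin r & {in r, forall x, c x y = c x z}].
Proof.
suff H (r' : seq nat) p : {subset r' <= r} -> exists s,
  [/\ uniq s, p <= size s, all (fun y => y \notin r) s &
    {in r', forall x, {in s &, forall y z, c x y = c x z}}].
  have [//|s [us ps ar h]] := H r 2.
  case: s us ps ar h => [|y [|z s]] // us _ ar h.
  exists y, z; case/and3P: ar => -> -> _; split=> //.
    by move: us; rewrite /= inE negb_or => /andP[/andP[]].
  by move=> x xr; apply: h; rewrite // !inE eqxx ?orbT.
elim: r' p => [|x r' IH] p sr.
  exists (iota (\max_(x <- r) x).+1 p); rewrite iota_uniq size_iota; split=> //.
  apply/allP => y; rewrite mem_iota => /andP[+ _]; apply: contraL => yr.
  by rewrite -leqNgt; apply: (leq_bigmax_seq (F := id)).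
have [|s [us ps ar hs]] := IH (p.+1 * (size l).+1).
  by move=> y yr; apply: sr; rewrite inE yr orbT.
have xr := sr x (mem_head _ _).
have [[g [s' [h1 h2 h3]]]|[s' [h1 h2 h3]]] := mono_or_rainbow (c x) ps; last first.
  have : size (map (c x) s') <= size l.
    apply: uniq_leq_size => // g /mapP[y /(mem_subseq h1)/(allP ar) yr ->].
    by apply: cl; apply: contraNneq yr => <-.
  by rewrite size_map h2 ltnn.
exists s'; split.
- exact: subseq_uniq us.
- exact: ltnW.
- by apply/allP => y /(mem_subseq h1)/(allP ar).
- move=> v; rewrite inE => /predU1P[->|vr] y z ys zs.
    by rewrite (eqP (allP h3 _ ys)) (eqP (allP h3 _ zs)).
  by apply: hs => //; apply: (mem_subseq h1).
Qed.

(** A triangle with exactly two sides of the same colour is found from twins [u], [v]: its apex is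
    an endpoint [r] with [c r u] other than [c u v], or else all four endpoints see [u] in colour
    [c u v] and one given edge has another colour. *)
Lemma exactly_two x y x' y' :
  x != y -> x' != y' -> c x y != c x' y' -> exactly c 2.
Proof.
move=> xy xy' ne.
have H a b d : uniq [:: a; b; d] -> c a b != c a d -> c a d = c b d -> exactly c 2.
  move=> us n1 n2; exists [:: a; b; d] => //.
  by rewrite /ncol /= -n2 !inE eqxx (negPf n1).
have [u [v [uv ur vr tw]]] := twin_vertices [:: x; y; x'; y'].
have [all_eq|] := boolP (all (fun r => c r u == c u v) [:: x; y; x'; y']).
  suff [a [b [h1 h2 h3 h4]]] : exists a b, [/\ a != b, a \in [:: x; y; x'; y'],
      b \in [:: x; y; x'; y'] & c a b != c u v].
    apply: (H a b u).
    - rewrite /= !inE negb_or h1 /= andbT.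
      by apply/andP; split; apply: contraNneq ur => <-.
    - by rewrite (eqP (allP all_eq a h2)).
    - by rewrite (eqP (allP all_eq a h2)) (eqP (allP all_eq b h3)).
  have [E|ne1] := eqVneq (c x y) (c u v).
    exists x', y'; split; rewrite ?inE ?eqxx ?orbT //.
    by rewrite -E eq_sym.
  by exists x, y; rewrite !inE !eqxx !orbT.
case/allPn => r rr ne1; apply: (H u v r).
- rewrite /= !inE negb_or uv /= andbT.
  by apply/andP; split; [apply: contraNneq ur | apply: contraNneq vr] => ->.
- by rewrite eq_sym (csym u r).
- by rewrite !(csym _ r) tw.
Qed.

Lemma exactly_binomial n q : uniq q -> uniq (pair_colours c q) ->
  n <= size q -> exactly c 'C(n, 2).
Proof.
move=> uq pq nq; have tq := take_subseq q n.
exists (take n q); first exact: subseq_uniq uq.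
by rewrite ncol_rainbow ?size_takel // (subseq_uniq (subseq_pair_colours c tq)).
Qed.

(** An independent set first makes the colours at [y] new to the clique; then the colours at [y] are
    equal or distinct on many vertices. *)
Lemma exactly_binomial_succ n q : 0 < n -> uniq q -> uniq (pair_colours c q) ->
  let p := n.+1 * n in p.+1 * p <= size q -> exactly c 'C(n, 2).+1.
Proof.
move=> n0 uq cq p pq; have [y [z [yz yq zq tw]]] := twin_vertices q.
(* Avoiding [f x] removes the colour [c y x]; [x.+1] is merely some vertex other than [x]. *)
have /choice[f hf] x : exists v, v != x /\
    forall s', subseq s' q -> v \notin s' -> c y x \notin pair_colours c s'.
  have xx : x != x.+1 by rewrite neq_ltn leqnn.
  by have [v vx hv] := rainbow_colour_endpoint (c y x) xx uq cq; exists v.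
have [s [sq sp si]] := independent_set (fun x => (hf x).1) uq pq.
have {si} ns : {in s, forall x, c y x \notin pair_colours c s}.
  by move=> x xs; apply: (hf x).2 => //; apply: si.
have us := subseq_uniq sq uq.
have [|[g [s1 [h1 h2 h3]]]|[s1 [h1 h2 h3]]] := @mono_or_rainbow _ _ (c y) n n s.
- by rewrite sp.
- pose s2 := take n s1.
  have s2s : subseq s2 s by apply: subseq_trans h1; apply: take_subseq.
  have s2n : size s2 = n by rewrite size_takel // ltnW.
  have gs2 : map (c y) s2 = nseq n g.
    rewrite -s2n -(size_map (c y)); apply/all_pred1P; rewrite all_map.
    by apply/allP => x /mem_take/(allP h3).
  have pc2 := subseq_pair_colours c (subseq_trans s2s sq).
  exists (y :: s2).
    rewrite /= (subseq_uniq s2s us) andbT; apply: contra yq => ys2.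
    exact: (mem_subseq (subseq_trans s2s sq)).
  rewrite (@ncol_eq _ _ _ _ (g :: pair_colours c s2)).
  + by rewrite /= size_pair_colours s2n.
  + rewrite /= (subseq_uniq pc2) // andbT.
    case: s2 s2s s2n gs2 {pc2} => [|x s2] s2s s2n gs2; first by move: n0; rewrite -s2n.
    have -> : g = c y x by move: gs2; rewrite -s2n => -[].
    have xs := mem_subseq s2s (mem_head _ _).
    apply: contra (ns x xs); exact: (mem_subseq (subseq_pair_colours c s2s)).
  + by move=> h; rewrite /= mem_cat gs2 mem_nseq n0 inE.
have s1q := subseq_trans h1 sq.
have us1 : uniq (y :: s1).
  by rewrite /= (subseq_uniq h1 us) andbT; apply: contra yq; apply: mem_subseq.
have rs1 : uniq (pair_colours c (y :: s1)).
  rewrite /= cat_uniq h3 (subseq_uniq (subseq_pair_colours c s1q)) // andbT.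
  apply/hasPn => g gs1; apply/negP => /mapP[x /(mem_subseq h1)/ns + gE].
  by rewrite -gE (mem_subseq (subseq_pair_colours c h1) gs1).
(* Deleting [v], which is not [y], makes [c y z] a new colour; [n - 1] vertices of [s1] remain
   whether or not [v] is among them. *)
have [v vy hv] := rainbow_colour_endpoint (c y z) yz us1 rs1.
pose s3 := take n.-1 (rem v s1).
have s31 : subseq s3 s1 by apply: subseq_trans (take_subseq _ _) (rem_subseq _ _).
have s3n : size s3 = n.-1.
  apply: size_takel; case: (boolP (v \in s1)) => vs1.
    by rewrite size_rem ?h2.
  by rewrite rem_id // h2 leq_pred.
have ys31 : subseq (y :: s3) (y :: s1) by rewrite /= eqxx.
have vs3 : v \notin y :: s3.
  rewrite inE negb_or vy; apply/negP => /mem_take.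
  by rewrite mem_rem_uniq ?inE ?eqxx //; case/andP: us1.
have s3q : {subset s3 <= q} by apply: mem_subseq; apply: subseq_trans s1q.
exists (y :: z :: s3).
  have /= /andP[ys3 us3] := subseq_uniq ys31 us1.
  by rewrite /= inE negb_or yz ys3 us3 /= andbT; apply: contra zq => /s3q.
rewrite (@ncol_eq _ _ _ _ (c y z :: pair_colours c (y :: s3))).
- by rewrite /= -/(pair_colours c (y :: s3)) size_pair_colours /= s3n prednK.
- by rewrite cons_uniq hv // (subseq_uniq (subseq_pair_colours c ys31)).
- have E : map (c z) s3 = map (c y) s3.
    by apply/eq_in_map => x /s3q xq; rewrite !(csym _ x) tw.
  by move=> g; rewrite /= !inE !mem_cat E; case: (g \in map (c y) s3).
Qed.

End Infinite.

(** A rainbow star is a fan over a single vertex, so a star with [D] colours already yields the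
    count [m]; otherwise stars are bounded. *)
Lemma exactly_of_many_colours (K : eqType) n m : 2 < m ->
  m = 'C(n, 2) \/ m = 'C(n, 2).+1 -> exists t, forall c : nat -> nat -> K,
  (forall x y, c x y = c y x) ->
  forall l : seq K, (forall x y, x != y -> c x y \in l) ->
  forall w : seq (nat * nat), all (fun e => e.1 != e.2) w ->
  uniq [seq c e.1 e.2 | e <- w] -> t <= size w -> exactly c m.
Proof.
move=> m2 mE; have n0 : 0 < n by case: n mE => // -[] mE; move: m2; rewrite mE.
(* [p.+1 * p] is the clique size asked for by the successor case; the extra one makes [1 + N.-1]
   equal to [N]. *)
pose p := n.+1 * n; pose N := (p.+1 * p).+1.
have [D fanD] := @rainbow_or_exactly_of_fan nat K N m N.-1 m2.
have [t ht] := @exactly_of_bounded_stars nat K m D m2.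
exists t => c csym l cl w wn wu wt; apply: contrapT => nG.
apply: (nG); apply: (ht c csym _ w wn wu wt) => v s vs us; rewrite ltnNge; apply/negP => Ds.
have fs : fan c [:: v] s.
  by split=> //=; [rewrite vs (map_uniq us) | move=> x; rewrite inE => /eqP ->].
have [[q [uq qN cq]]|//] := fanD c csym [:: v] s isT (erefl _) fs Ds.
apply: nG; case: mE => ->.
  by apply: exactly_binomial uq cq _; rewrite qN /N /p; nia.
by apply: exactly_binomial_succ csym cl _ _ n0 uq cq _; rewrite qN.
Qed.

(** * From lists of vertices to sets of naturals *)

Section Transfer.

Local Open Scope classical_set_scope.
Local Open Scope card_scope.

Lemma card_mem_seq (T : choiceType) (l : seq T) :
  [set x | x \in l] #= `I_(size (undup l)).
Proof.
rewrite (_ : [set x | x \in l] = [set` seq_fset tt l]).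
  by apply/card_eq_fsetP; rewrite size_seq_fset.
by apply/seteqP; split=> x; rewrite /mkset seq_fsetE.
Qed.

Lemma colours_on_of_exactly (T : Type) (c : set nat -> T) (f : T -> nat) m :
  set_inj (colours_on c setT) f -> exactly (fun x y => f (c [set x; y])) m ->
  exists X, colours_on c X #= `I_m.
Proof.
move=> finj [s us <-]; exists [set x | x \in s].
set A := colours_on c _.
have sub : A `<=` colours_on c setT.
  by apply: image_subset => e [x [y [_ _ xy ->]]]; exists x, y.
apply: card_eq_trans (card_mem_seq _).
rewrite (_ : [set x | _] = f @` A).
  rewrite card_eq_sym; apply: inj_card_eq => a b /set_mem/sub Aa /set_mem/sub Ab.
  by apply: finj; apply/mem_set.
have fsym x y : f (c [set x; y]) = f (c [set y; x]) by rewrite setUC.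
apply/seteqP; split=> g /=.
  case/(pair_coloursP fsym _ us) => x [y [xs ys /eqP xy ->]].
  by exists (c [set x; y]) => //; exists [set x; y] => //; exists x, y.
case=> _ [_ [x [y [xs ys /eqP xy ->]]] <-] <-.
by apply/(pair_coloursP fsym _ us); exists x, y.
Qed.

End Transfer.

Theorem theorem4 (n : nat) :
  exists C : nat, forall k : nat, C <= k ->
    F nat k 'C(n, 2) /\ F nat k ('C(n, 2) + 1).
Proof.
suff H m : m = 'C(n, 2) \/ m = 'C(n, 2).+1 ->
    exists C : nat, forall k : nat, C <= k -> F nat k m.
  have [C1 h1] := H _ (or_introl erefl); have [C2 h2] := H _ (or_intror erefl).
  exists (maxn C1 C2) => k; rewrite geq_max addn1 => /andP[k1 k2].
  by split; [apply: h1 | apply: h2].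
move=> mE.
suff [C hC] : exists C, forall c : nat -> nat -> nat,
    (forall x y, c x y = c y x) -> forall k, C <= k ->
    (forall x y, x != y -> c x y < k) ->
    (forall i, i < k -> exists x y, x != y /\ c x y = i) -> exactly c m.
  exists C => k Ck T c /card_set_bijP[f [ff fi fs]].
  apply: (colours_on_of_exactly fi); apply: hC Ck _ _.
  - by move=> x y; rewrite setUC.
  - by move=> x y /eqP xy; apply: ff; exists [set x; y]%classic => //; exists x, y.
  - move=> i /fs[_ [_ [x [y [_ _ /eqP xy ->]]] <-] <-]; exists x, y; split=> //.
have [m2|m2] := ltnP 2 m.
  have [C hC] := exactly_of_many_colours nat m2 mE; exists C => c csym k Ck cb cs.
  (* [h i] is an edge of colour [i], with default [(0, 0)] beyond the colours. *)
  have /choice[h hh] i : exists e : nat * nat, i < k ->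
      e.1 != e.2 /\ c e.1 e.2 = i.
    have [/cs[x [y xy]]|_] := ltnP i k; first by exists (x, y).
    by exists (0, 0).
  apply: (hC c csym (iota 0 k) _ (map h (iota 0 k))).
  - by move=> x y /cb; rewrite mem_iota.
  - by apply/allP => _ /mapP[i + ->]; rewrite mem_iota => /hh[].
  - rewrite -map_comp (_ : map _ _ = iota 0 k) ?iota_uniq //.
    by apply: map_id_in => i; rewrite mem_iota => /hh[].
  - by rewrite size_map size_iota.
(* Counts up to two come from the empty set, one edge, and two differently coloured edges. *)
exists 2 => c csym k k2 cb cs; case: m m2 {mE} => [|[|[|//]]] _.
- by exists [::].
- by exists [:: 0; 1].
have [x [y [xy E]]] := cs 0 (ltnW k2); have [x' [y' [xy' E']]] := cs 1 k2.
apply: (exactly_two (l := iota 0 k) csym _ xy xy'); last by rewrite E E'.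
by move=> u v /cb; rewrite mem_iota.
Qed.
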